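(* Let $p\in(0,1)$ and $p_N\in[0,1]$, let $S\sim\mathrm{Ber}(p)$ and $N\sim\mathrm{Ber}(p_N)$ be independent, let $X=S\oplus N$ (addition modulo 2), and for $\sigma>0$ let $X^\sigma=X+\sigma Z$ with $Z\sim\mathcal N(0,1)$ independent of $(S,N)$. Let $\mathcal H=\{x\mapsto s(ax+b):a,b\in\mathbb R\}$. Write $\overline{r}=1-r$ and $q:=p_N\overline p+\overline{p_N}p$. Then there are constants $C_1(p,p_N)$ and $C_2(p,p_N)$, not depending on $\sigma$, such that, as $\sigma\to\infty$, $$\begin{aligned}\epsilon_A\le\ &\frac{3(1-2p_N)^2}{4\sigma^2}-\frac{(1-2p_N)^2}{4(q\overline q+\sigma^2)}+\frac{(1-2p_N)^2(5-4p_N+4p_N^2+14q-2q^2)}{8\sigma^4}\\&+\frac{2(1-2p_N)^2(p_N\overline{p_N}-q\overline q)}{4\sigma^2(q\overline q+\sigma^2)}+\mathcal O\left(\frac{C_1(p,p_N)(1-2p_N)^2}{\sigma^6}\right)+\mathcal O\left(\frac{C_2(p,p_N)(1-2p_N)^2}{\sigma^4(q\overline q+\sigma^2)}\right).\end{aligned}$$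
   Context: $s(z)=1/(1+e^{-z})$ is the sigmoid function. $\eta^\sigma(x)=\mathbb E[S\vert X^\sigma=x]$. $h^*_{\mathcal H}\in\arg\min_{h\in\mathcal H}\mathbb E[(S-h(X^\sigma))^2]$ denotes a minimizer over $\mathcal H$ (the minimum is assumed attained), and $\epsilon_A:=\mathbb E[(\eta^\sigma(X^\sigma)-h^*_{\mathcal H}(X^\sigma))^2]$, which depends on $\sigma$. The $\mathcal O$ terms are for $p,p_N$ fixed and $\sigma\to\infty$: for all sufficiently large $\sigma$ the inequality holds with the two $\mathcal O(\cdot)$ terms replaced by quantities bounded in absolute value by constants (depending only on $p,p_N$) times $(1-2p_N)^2/\sigma^6$ and $(1-2p_N)^2/(\sigma^4(q\overline q+\sigma^2))$ respectively. *)

(* Defs.v *)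
From HB Require Import structures.
From mathcomp Require Export all_boot all_order all_algebra.
From mathcomp Require Export all_classical all_reals all_analysis.

Set Implicit Arguments.
Unset Strict Implicit.
Unset Printing Implicit Defensive.

Export Order.TTheory GRing.Theory Num.Theory.
Export numFieldNormedType.Exports.

Local Open Scope classical_set_scope.
Local Open Scope ring_scope.

Definition sigmoid (R : realType) (z : R) : R := 1 / (1 + expR (- z)).

Definition sigmoid_class (R : realType) : set (R -> R) :=
  [set h | exists a b : R, h = (fun x => sigmoid (a * x + b))].
Arguments sigmoid_class R : clear implicits.

(* Laws are compared on measurable sets only: [normal_prob] is a measure on
   the Borel sets but a total function on [set R], so that plain function
   equality would also constrain it on non-measurable sets. *)
Definition has_law d d' (T : measurableType d) (U : measurableType d')
    (R : realType) (P : probability T R) (X : {RV P >-> U})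
    (mu : set U -> \bar R) : Prop :=
  forall A : set U, measurable A -> distribution P X A = mu A.

Definition independent_rv d d1 d2 (T : measurableType d)
    (U : measurableType d1) (V : measurableType d2) (R : realType)
    (P : probability T R) (X : T -> U) (Y : T -> V) : Prop :=
  forall (A : set U) (B : set V), measurable A -> measurable B ->
    P (X @^-1` A `&` Y @^-1` B) = (P (X @^-1` A) * P (Y @^-1` B))%E.

(* [eta] is a version of x |-> E[Y | X = x]: it is Borel, and [eta \o X]
   is a version of E[Y | sigma(X)]. *)
Definition is_regression d (T : measurableType d) (R : realType)
    (P : probability T R) (Y X : T -> R) (eta : R -> R) : Prop :=
  [/\ measurable_fun [set: R] eta,
      P.-integrable [set: T] (fun w => (eta (X w))%:E)
    & forall B : set R, measurable B ->
        (\int[P]_(w in X @^-1` B) (eta (X w))%:E =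
         \int[P]_(w in X @^-1` B) (Y w)%:E)%E ].

Definition is_best_predictor d (T : measurableType d) (R : realType)
    (P : probability T R) (H : set (R -> R)) (Y X : T -> R)
    (h : R -> R) : Prop :=
  H h /\
  forall g : R -> R, H g ->
    ('E_P[fun w => ((Y w - h (X w)) ^+ 2)%R] <=
     'E_P[fun w => ((Y w - g (X w)) ^+ 2)%R])%E.

Definition bitR (R : realType) (T : Type) (S : T -> bool) : T -> R :=
  fun w => (S w)%:R.
Arguments bitR R {T} S _.

Definition noisy_obs (R : realType) (T : Type) (S N : T -> bool)
    (Z : T -> R) (sigma : R) : T -> R :=
  fun w => (S w (+) N w)%:R + sigma * Z w.

Definition approx_error d (T : measurableType d) (R : realType)
    (P : probability T R) (X : T -> R) (eta h : R -> R) : \bar R :=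
  'E_P[fun w => (eta (X w) - h (X w)) ^+ 2].

(* Main.v *)
Require Import Defs.
From HB Require Import structures.
From mathcomp Require Import measurable_realfun ring lra.

(* The constant predictor [p] belongs to the sigmoid class, and the mean
   squared error of a predictor exceeds that of the posterior by its squared
   L2-distance to the posterior, so [approx_error] is at most the variance of the posterior.
   Rescaled by [sigma], the observation is a mixture of normal laws centred at
   [0] and [1 / sigma]; up to the factor [(p (1 - p) (1 - 2 pN))^2] that
   variance is the integral of [(g1 - g0)^2 / ((1 - q) g0 + q g1)], which is at
   most the chi-square divergence [exp (1 / sigma^2) - 1] by convexity of the
   inverse.  Hence [approx_error] is at most [(1 - 2 pN)^2 / (8 sigma^2)] once
   [sigma >= 2], whereas the explicit terms of the bound add up to about
   [(1 - 2 pN)^2 / (2 sigma^2)]: they suffice with both remainders zero. *)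

Set Implicit Arguments.
Unset Strict Implicit.
Unset Printing Implicit Defensive.

Local Open Scope classical_set_scope.
Local Open Scope ring_scope.

(** * Integration against normal laws and joint laws of independent variables *)

Lemma lebesgue_measure_shift (R : realType) (t : R) (A : set R) :
  measurable A ->
  pushforward lebesgue_measure (fun z : R => z + t : measurableTypeR R) A
  = lebesgue_measure A.
Proof.
have mt : measurable_fun [set: R] (fun z : R => z + t : measurableTypeR R).
  exact: measurable_funD.
pose f : {mfun R >-> measurableTypeR R} := HB.pack (fun z : R => z + t)
  (isMeasurableFun.Build _ _ _ _ _ mt).
move=> mA; apply/esym.
apply: (@lebesgue_measure_unique R (pushforward lebesgue_measure f)) => //=.
move=> _ [[a b]] _ <-.
have -> : pushforward lebesgue_measure f `]a, b] =
          lebesgue_measure `]a - t, b - t].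
  rewrite /pushforward; congr lebesgue_measure; apply/seteqP; split => z /=;
    by rewrite !in_itv/= ltrBlDr lerBrDr.
rewrite !lebesgue_measure_itv/= !lte_fin ltrD2r.
by case: ifP => // _; rewrite -!EFinB; congr _%:E; ring.
Qed.

(** The Radon-Nikodym derivative of [normal_prob] and [normal_pdf] have the same integral over every
    measurable set, hence agree almost everywhere. *)
Lemma ge0_integral_normal_prob (R : realType) (m s : R) (f : R -> \bar R) :
  measurable_fun [set: R] f -> (forall x, 0 <= f x)%E ->
  (\int[normal_prob m s]_x f x =
   \int[lebesgue_measure]_x (f x * (normal_pdf m s x)%:E))%E.
Proof.
move=> mf f0.
rewrite -(@Radon_Nikodym_SigmaFinite.change_of_variables _ _ _
  (normal_prob m s) (@lebesgue_measure R) (normal_prob_dominates m s) f)//.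
have dom : normal_prob m s `<< @lebesgue_measure R := normal_prob_dominates m s.
have iRN := Radon_Nikodym_SigmaFinite.f_integrable dom.
have mpdf : measurable_fun [set: R] (fun x => (normal_pdf m s x)%:E).
  by apply/measurable_EFinP; exact: measurable_normal_pdf.
apply: ae_eq_integral => //.
- by apply: emeasurable_funM => //; exact: measurable_int iRN.
- exact: emeasurable_funM.
- apply: ae_eqe_mul2l => /=; apply: integral_ae_eq => //= E _ mE.
  by rewrite -Radon_Nikodym_SigmaFinite.f_integral.
Qed.

(** Substitution [x = z + t] in the Lebesgue integral: the density centred at [t], taken at [z + t],
    is the standard density at [z]. *)
Lemma ge0_integral_normal_prob_shift (R : realType) (t : R) (f : R -> \bar R) :
  measurable_fun [set: R] f -> (forall x, 0 <= f x)%E ->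
  (\int[normal_prob 0 1]_x f (x + t)%R =
   \int[lebesgue_measure]_x (f x * (normal_pdf t 1 x)%:E))%E.
Proof.
move=> mf f0.
have mt : measurable_fun [set: R] (fun z : R => z + t : measurableTypeR R).
  exact: measurable_funD.
have mft : measurable_fun [set: R] (fun z : R => f (z + t)).
  by apply: (measurableT_comp mf); exact: measurable_funD.
rewrite (ge0_integral_normal_prob 0 1 mft); last by [].
have mg : measurable_fun [set: R] (fun x => (f x * (normal_pdf t 1 x)%:E)%E).
  apply: emeasurable_funM => //.
  by apply/measurable_EFinP; exact: measurable_normal_pdf.
transitivity (\int[pushforward (@lebesgue_measure R)
    (fun z : R => (z + t)%R : measurableTypeR R)]_x
    (f x * (normal_pdf t 1 x)%:E))%E; last first.
  by apply: eq_measure_integral => A mA _; exact: lebesgue_measure_shift.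
rewrite ge0_integral_pushforward; last 4 first.
- exact: mt.
- exact: measurableT.
- exact: mg.
- by move=> x _; rewrite mule_ge0 ?f0// lee_fin normal_pdf_ge0.
rewrite preimage_setT; apply: eq_integral => x _ /=.
by rewrite /normal_pdf oner_eq0 /normal_fun subr0 addrK.
Qed.

Lemma ge0_integral_comb d (T : measurableType d) (R : realType)
    (mu : {measure set T -> \bar R}) (a b : R) (f g : T -> R) :
  0 <= a -> 0 <= b ->
  measurable_fun [set: T] f -> measurable_fun [set: T] g ->
  (forall x, 0 <= f x) -> (forall x, 0 <= g x) ->
  (\int[mu]_x (a * f x + b * g x)%:E =
   a%:E * \int[mu]_x (f x)%:E + b%:E * \int[mu]_x (g x)%:E)%E.
Proof.
move=> a0 b0 mf mg f0 g0.
under eq_integral do rewrite EFinD !EFinM.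
rewrite ge0_integralD//; do ?[
  by move=> x _; rewrite -EFinM lee_fin mulr_ge0 |
  by apply/measurable_EFinP; exact: measurable_funM].
by rewrite !ge0_integralZl//; do ?[by move=> x _; rewrite lee_fin |
  exact/measurable_EFinP | by rewrite lee_fin].
Qed.

(** Independence fixes the joint law on rectangles, and these determine the product measure. Applied
    first to [(S, N)], then to [((S, N), Z)]. *)
Lemma joint_law_product d d1 d2 (T : measurableType d) (U : measurableType d1)
    (V : measurableType d2) (R : realType) (P : probability T R)
    (X : T -> U) (Y : T -> V) (mu : probability U R) (nu : probability V R) :
  measurable_fun [set: T] X -> measurable_fun [set: T] Y ->
  (forall A, measurable A -> P (X @^-1` A) = mu A) ->
  (forall B, measurable B -> P (Y @^-1` B) = nu B) ->
  independent_rv P X Y ->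
  forall C, measurable C ->
    P ((fun w => (X w, Y w)) @^-1` C) = (mu \x nu)%E C.
Proof.
move=> mX mY lX lY indep C mC.
have mXY : measurable_fun [set: T] (fun w => (X w, Y w)).
  exact: measurable_fun_pair.
pose XY : {mfun T >-> (U * V)%type} := HB.pack (fun w => (X w, Y w))
  (isMeasurableFun.Build _ _ _ _ _ mXY).
rewrite (@product_measure_unique _ _ _ _ _ mu nu (distribution P XY))//.
by move=> A B mA mB; have := indep A B mA mB; rewrite lX// lY//.
Qed.

(** * Joint law of the bit and the noisy observation *)

Section noisy_observation_law.
Context (R : realType) (p pN sigma : R).
Context d (T : measurableType d) (P : probability T R).
Context (S N : {RV P >-> bool}) (Z : {RV P >-> R}).
Hypotheses (p01 : 0 <= p <= 1) (pN01 : 0 <= pN <= 1) (sigma_gt0 : 0 < sigma).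
Hypotheses (lS : has_law S (bernoulli_prob p))
  (lN : has_law N (bernoulli_prob pN)) (lZ : has_law Z (normal_prob 0 1)).
Hypotheses (SN : independent_rv P S N)
  (SNZ : independent_rv P (fun w => (S w, N w)) Z).

Local Notation pdf0 := (normal_pdf (0 : R) 1).
Local Notation pdf1 := (normal_pdf sigma^-1 1).

Lemma measurable_noisy_obs : measurable_fun [set: T] (noisy_obs S N Z sigma).
Proof.
apply: measurable_funD.
  apply: (measurableT_comp (f := fun b : bool => b%:R : R)) => //.
  apply: (eq_measurable_fun (fun w => if S w then ~~ N w else N w)).
    by move=> w _; case: (S w).
  by apply: measurable_fun_ifT => //; exact: measurableT_comp.
exact: measurable_funM.
Qed.

(** Rescaled by [sigma], the observation has unit noise, centred at [0] if [S = N] and at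
    [1 / sigma] otherwise. Letting [f] depend on the bit captures the joint law, from which the
    posterior is read off. *)
Lemma integral_noisy_obs (f : bool -> R -> R) :
  (forall b, measurable_fun [set: R] (f b)) -> (forall b x, 0 <= f b x) ->
  (\int[P]_w (f (S w) (noisy_obs S N Z sigma w))%:E =
   \int[lebesgue_measure]_z
     (f true (sigma * z) * (p * (pN * pdf0 z + (1 - pN) * pdf1 z)) +
      f false (sigma * z) * ((1 - p) * ((1 - pN) * pdf0 z + pN * pdf1 z)))%:E)%E.
Proof.
move=> mf f0.
have mSN : measurable_fun [set: T] (fun w => (S w, N w)).
  exact: measurable_fun_pair.
have lSN := joint_law_product (mu := bernoulli_prob p) (nu := bernoulli_prob pN)
  (measurable_funPT S) (measurable_funPT N) lS lN SN.
have lSNZ := joint_law_product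
  (mu := (bernoulli_prob p \x bernoulli_prob pN)%E) (nu := normal_prob 0 1)
  mSN (measurable_funPT Z) lSN lZ SNZ.
(* [normal_prob] lives on [measurableTypeR R], whose display is not the default
   one of [R]. *)
have mZ : measurable_fun [set: T] (Z : T -> measurableTypeR R).
  have mZ0 := measurable_funPT Z; exact: mZ0.
pose g (u : (bool * bool) * measurableTypeR R) : \bar R :=
  (f u.1.1 ((u.1.1 (+) u.1.2)%:R + sigma * u.2))%:E.
have g0 u : (0 <= g u)%E by rewrite lee_fin.
have mg : measurable_fun setT g.
  apply/measurable_EFinP.
  have mS : measurable_fun setT (fun u : (bool * bool) * measurableTypeR R => u.1.1).
    exact: measurableT_comp measurable_fst measurable_fst.
  have mN : measurable_fun setT (fun u : (bool * bool) * measurableTypeR R => u.1.2).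
    exact: measurableT_comp measurable_snd measurable_fst.
  have mx : measurable_fun setT (fun u : (bool * bool) * measurableTypeR R =>
      (u.1.1 (+) u.1.2)%:R + sigma * u.2).
    apply: measurable_funD; last exact: measurable_funM.
    apply: (measurableT_comp (f := fun b : bool => b%:R : R)) => //.
    apply: (eq_measurable_fun (fun u : (bool * bool) * measurableTypeR R =>
      if u.1.1 then ~~ u.1.2 else u.1.2)).
      by move=> u _; case: (u.1.1).
    by apply: measurable_fun_ifT => //; exact: measurableT_comp.
  apply: (eq_measurable_fun (fun u : (bool * bool) * measurableTypeR R =>
    if u.1.1 then f true ((u.1.1 (+) u.1.2)%:R + sigma * u.2)
    else f false ((u.1.1 (+) u.1.2)%:R + sigma * u.2))).
    by move=> u _; case: (u.1.1).
  by apply: measurable_fun_ifT => //; apply: measurableT_comp mx.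
have mSNZ : measurable_fun [set: T] (fun w => ((S w, N w), Z w : measurableTypeR R)).
  exact: measurable_fun_pair.
transitivity (\int[pushforward P
    (fun w => ((S w, N w), Z w : measurableTypeR R))]_u g u)%E.
  by rewrite ge0_integral_pushforward.
transitivity (\int[((bernoulli_prob p \x bernoulli_prob pN)
    \x normal_prob 0 1)%E]_u g u)%E.
  by apply: eq_measure_integral => C mC _; exact: lSNZ.
(* Tonelli is used twice: [h] integrates [Z] out, and the remaining integrals over [N] and [S] are
   two-term weighted sums. *)
pose h (u : bool * bool) : \bar R := (\int[normal_prob 0 1]_z g (u, z))%E.
have h0 u : (0 <= h u)%E by apply: integral_ge0 => z _; exact: g0.
have mh : measurable_fun setT h.
  exact: (measurable_fun_fubini_tonelli_F (m2 := normal_prob 0 1) g mg g0).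
pose pSN : probability (bool * bool)%type R :=
  (bernoulli_prob p \x bernoulli_prob pN)%E.
rewrite (fubini_tonelli1 (m1 := pSN) (m2 := normal_prob 0 1) g mg g0).
rewrite (fubini_tonelli1 (m1 := bernoulli_prob p) (m2 := bernoulli_prob pN)
  h mh h0).
rewrite /fubini_F integral_bernoulli_prob//; last first.
  by move=> b; apply: integral_ge0 => c _; exact: h0.
rewrite !integral_bernoulli_prob; do ?[by [] | by move=> b; exact: h0].
have mfs b : measurable_fun [set: R] (fun z => (f b (sigma * z))%:E).
  by apply/measurable_EFinP; apply: measurableT_comp => //; exact: measurable_funM.
have I0 b : (\int[normal_prob 0 1]_z (f b (0%:R + sigma * z))%:E =
    \int[lebesgue_measure]_z (f b (sigma * z) * pdf0 z)%:E)%E.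
  under eq_integral do rewrite add0r.
  rewrite ge0_integral_normal_prob//.
  by move=> x; rewrite lee_fin.
(* Since [1 + sigma * z = sigma * (z + 1 / sigma)], this is a shift by [1 / sigma]. *)
have I1 b : (\int[normal_prob 0 1]_z (f b (1%:R + sigma * z))%:E =
    \int[lebesgue_measure]_z (f b (sigma * z) * pdf1 z)%:E)%E.
  rewrite -(@ge0_integral_normal_prob_shift _ sigma^-1
    (fun z => (f b (sigma * z))%:E))//; last by move=> x; rewrite lee_fin.
  apply: eq_integral => z _.
  by rewrite mulrDr divff ?gt_eqF// addrC.
rewrite /h /g /= !I0 !I1.
have [pdf0_ge0 pdf1_ge0] : (forall z, 0 <= pdf0 z) /\ (forall z, 0 <= pdf1 z).
  by split=> z; exact: normal_pdf_ge0.
have [mpdf0 mpdf1] : measurable_fun setT pdf0 /\ measurable_fun setT pdf1.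
  by split; exact: measurable_normal_pdf.
have mfR b : measurable_fun [set: R] (fun z => f b (sigma * z)).
  by apply: measurableT_comp => //; exact: measurable_funM.
have [[p0 p1] [pN0 pN1]] : (0 <= p /\ 0 <= 1 - p) /\ (0 <= pN /\ 0 <= 1 - pN).
  by move: p01 pN01; rewrite !subr_ge0 => /andP[-> ->] /andP[-> ->].
pose u b z := f b (sigma * z) * pdf0 z; pose v b z := f b (sigma * z) * pdf1 z.
have u0 b z : 0 <= u b z by exact: mulr_ge0.
have v0 b z : 0 <= v b z by exact: mulr_ge0.
have mu b : measurable_fun [set: R] (u b) by exact: measurable_funM.
have mv b : measurable_fun [set: R] (v b) by exact: measurable_funM.
(* [F] and [G] average over [N] with [S] true and false respectively; the roles of [u] and [v] swap
   because the flip acts on the opposite bit. *)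
pose F z := pN * u true z + (1 - pN) * v true z.
pose G z := pN * v false z + (1 - pN) * u false z.
have mF : measurable_fun [set: R] F.
  by apply: measurable_funD; apply: measurable_funM => //; exact: mu.
have mG : measurable_fun [set: R] G.
  by apply: measurable_funD; apply: measurable_funM => //; exact: mu.
have F0 z : 0 <= F z by rewrite addr_ge0// mulr_ge0// ?u0 ?v0.
have G0 z : 0 <= G z by rewrite addr_ge0// mulr_ge0// ?u0 ?v0.
transitivity (\int[lebesgue_measure]_z (p * F z + (1 - p) * G z)%:E)%E.
  rewrite (ge0_integral_comb lebesgue_measure p0 p1 mF mG F0 G0).
  rewrite (ge0_integral_comb lebesgue_measure pN0 pN1
    (mu true) (mv true) (u0 true) (v0 true)).
  by rewrite (ge0_integral_comb lebesgue_measure pN0 pN1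
    (mv false) (mu false) (v0 false) (u0 false)).
by apply: eq_integral => z _; congr _%:E; rewrite /F /G /u /v; ring.
Qed.
End noisy_observation_law.

(** * Chi-square bound for two unit-variance normal densities *)

Lemma normal_pdf_gt0 (R : realType) (m s x : R) : s != 0 ->
  0 < normal_pdf m s x.
Proof. by move=> s0; rewrite normal_pdfE// mulr_gt0 ?expR_gt0 ?normal_peak_gt0. Qed.

(** Completing the square: [2 (x - b)^2 - (x - a)^2 = (x - (2 b - a))^2 - 2 (b - a)^2]. The quotient
    is thus a multiple of a normal density and its integral is explicit. *)
Lemma normal_pdf_sqr_div (R : realType) (a b x : R) :
  normal_pdf b 1 x ^+ 2 / normal_pdf a 1 x =
  expR ((b - a) ^+ 2) * normal_pdf (2 * b - a) 1 x.
Proof.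
have pdfE m : normal_pdf m 1 x = normal_peak 1 * expR (- (x - m) ^+ 2 / 2).
  by rewrite normal_pdfE ?oner_neq0// /normal_fun expr1n.
apply: (canLR (mulfK (lt0r_neq0 (normal_pdf_gt0 a x (oner_neq0 R))))).
rewrite !pdfE expr2 mulrACA -expRD.
rewrite [RHS](_ : _ = normal_peak 1 * normal_peak 1 *
  expR ((b - a) ^+ 2 + (- (x - (2 * b - a)) ^+ 2 / 2 + - (x - a) ^+ 2 / 2)));
  last by rewrite !expRD; ring.
by congr (_ * expR _); field.
Qed.

(** The coefficients may be negative, so integrability is carried through the induction together
    with the value. *)
Lemma integral_normal_pdf_sum (R : realType) (s : seq (R * R)) :
  (@lebesgue_measure R).-integrable [set: R]
    (fun x => (\sum_(i <- s) i.1 * normal_pdf i.2 1 x)%:E) /\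
  (\int[lebesgue_measure]_x (\sum_(i <- s) i.1 * normal_pdf i.2 1 x)%R%:E =
   (\sum_(i <- s) i.1)%:E)%E.
Proof.
elim: s => [|[c m] s [IHi IHe]].
  split; first by under eq_fun do rewrite big_nil; exact: integrable0.
  by rewrite big_nil; apply: integral0_eq => x _; rewrite big_nil.
have ic : (@lebesgue_measure R).-integrable [set: R]
    (fun x => c%:E * (normal_pdf m 1 x)%:E)%E.
  by apply: integrableZl => //; exact: integrable_normal_pdf.
split.
  under eq_fun do rewrite big_cons/= EFinD EFinM.
  exact: integrableD.
under eq_integral do rewrite big_cons/= EFinD EFinM.
rewrite integralD//= IHe integralZl//; last exact: integrable_normal_pdf.
by rewrite integral_normal_pdf mule1 big_cons EFinD.
Qed.

(** On positive values the inverse is [expR (- ln _)], a composition of measurable functions. *)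
Lemma measurable_invr_gt0 d (T : measurableType d) (R : realType) (f : T -> R) :
  measurable_fun [set: T] f -> (forall x, 0 < f x) ->
  measurable_fun [set: T] (fun x => (f x)^-1).
Proof.
move=> mf f0; apply: (eq_measurable_fun (fun x => expR (- ln (f x)))).
  by move=> x _; rewrite expRN lnK// posrE.
apply: measurableT_comp => //; apply: measurableT_comp => //.
by apply: measurableT_comp => //; exact: measurable_ln.
Qed.

(** Integrand of the Vincze-Le Cam divergence; [q = 0] and [q = 1] give the chi-square divergences
    in the two orders. *)
Definition chi2_density (R : realType) (q a b x : R) : R :=
  (normal_pdf b 1 x - normal_pdf a 1 x) ^+ 2 /
  ((1 - q) * normal_pdf a 1 x + q * normal_pdf b 1 x).

(** The endpoints are included because the weight is later taken to be [pN] or [1 - pN], which may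
    vanish. *)
Lemma normal_mixture_gt0 (R : realType) (q a b x : R) : 0 <= q <= 1 ->
  0 < (1 - q) * normal_pdf a 1 x + q * normal_pdf b 1 x.
Proof.
move=> /andP[q_ge0 q_le1].
have u0 := normal_pdf_gt0 a x (oner_neq0 R).
have v0 := normal_pdf_gt0 b x (oner_neq0 R).
move: q_ge0; rewrite le0r => /predU1P[->|q_gt0].
  by rewrite subr0 mul1r mul0r addr0.
apply: ltr_wpDl; last exact: mulr_gt0.
by apply: mulr_ge0; [rewrite subr_ge0|exact: ltW].
Qed.

Lemma chi2_density_ge0 (R : realType) (q a b x : R) : 0 <= q <= 1 ->
  0 <= chi2_density q a b x.
Proof.
by move=> q01; apply: divr_ge0; rewrite ?sqr_ge0// ltW// normal_mixture_gt0.
Qed.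

Lemma measurable_chi2_density (R : realType) (q a b : R) : 0 <= q <= 1 ->
  measurable_fun [set: R] (chi2_density q a b).
Proof.
have mpdf m : measurable_fun [set: R] (normal_pdf m 1).
  exact: measurable_normal_pdf.
move=> q01; apply: measurable_funM.
  by apply: measurable_funX; apply: measurable_funB; exact: mpdf.
apply: measurable_invr_gt0; last by move=> x; exact: normal_mixture_gt0.
by apply: measurable_funD; apply: measurable_funM => //; exact: mpdf.
Qed.

Lemma normal_pdf_chi2_mixture (R : realType) (q a b : R) : 0 < q < 1 ->
  (\int[lebesgue_measure]_x (chi2_density q a b x)%:E
   <= (expR ((b - a) ^+ 2) - 1)%:E)%E.
Proof.
move=> q01; have [q0 q1] := andP q01.
have q01W : 0 <= q <= 1 by rewrite !ltW.
(* With [u], [v] the densities at [a], [b], this lists the terms [v^2 / u], [v], [u], [u^2 / v] of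
   [(v - u)^2 ((1 - q) / u + q / v)], the upper bound given by convexity of the inverse. *)
pose s := [:: ((1 - q) * expR ((b - a) ^+ 2), 2 * b - a); (q - 2 * (1 - q), b);
  (1 - q - 2 * q, a); (q * expR ((a - b) ^+ 2), 2 * a - b)].
have [int_s int_sE] := integral_normal_pdf_sum s.
have -> : expR ((b - a) ^+ 2) - 1 = \sum_(i <- s) i.1.
  by rewrite !big_cons big_nil/= -[a - b]opprB sqrrN; ring.
rewrite -int_sE; apply: ge0_le_integral => //.
- by move=> x _; rewrite lee_fin chi2_density_ge0.
- by apply/measurable_EFinP; exact: measurable_chi2_density.
- exact: measurable_int int_s.
move=> x _; rewrite lee_fin !big_cons big_nil/=.
rewrite -!mulrA -!normal_pdf_sqr_div.
have := normal_mixture_gt0 a b x q01W; rewrite /chi2_density.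
have := normal_pdf_gt0 a x (oner_neq0 R).
have := normal_pdf_gt0 b x (oner_neq0 R).
move: (normal_pdf b 1 x) (normal_pdf a 1 x) => v u v0 u0 w0.
rewrite [leRHS](_ : _ = (v - u) ^+ 2 * ((1 - q) / u + q / v)); last first.
  by field; rewrite !gt_eqF.
apply: ler_wpM2l; first exact: sqr_ge0.
(* Convexity made explicit: after clearing the mixture, the gap is [q (1 - q) (v - u)^2 / (u v)]. *)
rewrite -div1r ler_pdivrMr// -subr_ge0.
rewrite [leRHS](_ : _ = q * (1 - q) * (v - u) ^+ 2 / (u * v)); last first.
  by field; rewrite !gt_eqF.
apply: divr_ge0; last by rewrite mulr_ge0 ?ltW.
by apply: mulr_ge0; rewrite ?sqr_ge0// mulr_ge0 ?subr_ge0 ?ltW.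
Qed.

(** * The posterior, its variance, and its agreement with any regression function *)

Section posterior.
Context (R : realType) (p pN sigma : R).
Context d (T : measurableType d) (P : probability T R).
Context (S N : {RV P >-> bool}) (Z : {RV P >-> R}).
Hypotheses (p01 : 0 < p < 1) (pN01 : 0 <= pN <= 1) (sigma_gt0 : 0 < sigma).
Hypotheses (lS : has_law S (bernoulli_prob p))
  (lN : has_law N (bernoulli_prob pN)) (lZ : has_law Z (normal_prob 0 1)).
Hypotheses (SN : independent_rv P S N)
  (SNZ : independent_rv P (fun w => (S w, N w)) Z).

Local Notation pdf0 := (normal_pdf (0 : R) 1).
Local Notation pdf1 := (normal_pdf sigma^-1 1).
Local Notation X := (noisy_obs S N Z sigma).
Local Notation q := (pN * (1 - p) + (1 - pN) * p).

(* The density at [z] of [noisy_obs / sigma] on the event [S = b]. *)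
Definition joint_density (b : bool) (z : R) : R :=
  if b then p * (pN * pdf0 z + (1 - pN) * pdf1 z)
  else (1 - p) * ((1 - pN) * pdf0 z + pN * pdf1 z).

(** Bayes' formula. The densities are those of the rescaled observation; the Jacobian factor cancels
    in the quotient. *)
Definition posterior (x : R) : R :=
  joint_density true (x / sigma) /
  (joint_density true (x / sigma) + joint_density false (x / sigma)).

Lemma integral_noisy_obs_density (f : bool -> R -> R) :
  (forall b, measurable_fun [set: R] (f b)) -> (forall b x, 0 <= f b x) ->
  (\int[P]_w (f (S w) (X w))%:E =
   \int[lebesgue_measure]_z
     (f true (sigma * z) * joint_density true z +
      f false (sigma * z) * joint_density false z)%:E)%E.
Proof.
move=> mf f0; case/andP: p01 => p_gt0 p_lt1.
by rewrite (integral_noisy_obs _ pN01 sigma_gt0 lS lN lZ)// !ltW.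
Qed.

Lemma joint_density_gt0 b z : 0 < joint_density b z.
Proof.
case/andP: p01 => p_gt0 p_lt1; case/andP: pN01 => pN0 pN1.
case: b; rewrite /joint_density; apply: mulr_gt0; rewrite ?subr_gt0//.
  rewrite -{1}[pN](subKr 1); apply: normal_mixture_gt0.
  by rewrite subr_ge0 pN1 gerBl.
by apply: normal_mixture_gt0; rewrite pN0.
Qed.

Lemma measurable_joint_density b : measurable_fun [set: R] (joint_density b).
Proof.
have mpdf m : measurable_fun [set: R] (normal_pdf m 1).
  exact: measurable_normal_pdf.
by case: b; apply: measurable_funM => //; apply: measurable_funD;
  apply: measurable_funM => //; exact: mpdf.
Qed.

Lemma measurable_posterior : measurable_fun [set: R] posterior.
Proof.
have md b : measurable_fun [set: R] (fun x => joint_density b (x / sigma)).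
  apply: (measurableT_comp (measurable_joint_density b)).
  exact: measurable_funM.
apply: measurable_funM; first exact: md.
apply: measurable_invr_gt0; first by apply: measurable_funD; exact: md.
by move=> x; rewrite addr_gt0 ?joint_density_gt0.
Qed.

Lemma posterior_itv x : 0 <= posterior x <= 1.
Proof.
have a0 := joint_density_gt0 true (x / sigma).
have b0 := joint_density_gt0 false (x / sigma).
rewrite /posterior; apply/andP; split.
  by rewrite divr_ge0 ?addr_ge0 ?ltW.
by rewrite ler_pdivrMr ?addr_gt0// mul1r lerDl ltW.
Qed.

Lemma posteriorM z : posterior (sigma * z) =
  joint_density true z / (joint_density true z + joint_density false z).
Proof.
rewrite /posterior; suff -> : sigma * z / sigma = z by [].
by rewrite mulrC mulKf// gt_eqF.
Qed.

(** The posterior times the total density is the density on [S = true]. Taking [k] to be an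
    indicator gives the defining property of the conditional expectation. *)
Lemma integral_bit_posterior (k : R -> R) :
  measurable_fun [set: R] k -> (forall x, 0 <= k x) ->
  (\int[P]_w (k (X w) * (S w)%:R)%:E =
   \int[P]_w (k (X w) * posterior (X w))%:E)%E.
Proof.
move=> mk k0.
rewrite (integral_noisy_obs_density (f := fun b x => k x * b%:R)); last 2 first.
- by move=> b; exact: measurable_funM.
- by move=> b x; rewrite mulr_ge0.
rewrite (integral_noisy_obs_density (f := fun b x => k x * posterior x)); last 2 first.
- by move=> b; apply: measurable_funM => //; exact: measurable_posterior.
- by move=> b x; rewrite mulr_ge0//; case/andP: (posterior_itv x).
apply: eq_integral => z _; congr _%:E.
rewrite posteriorM mulr1 mulr0 mul0r addr0.
have := joint_density_gt0 true z; have := joint_density_gt0 false z.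
move: (joint_density true z) (joint_density false z) => a b b0 a0.
by field; rewrite gt_eqF// addr_gt0.
Qed.

(** Pointwise bias-variance identity [r (1 - k)^2 + (1 - r) k^2 = (r - k)^2 + r (1 - r)], with [r]
    the posterior. The last term is the same for all predictors. *)
Lemma mean_square_error_posterior (k : R -> R) :
  measurable_fun [set: R] k ->
  (\int[P]_w (((S w)%:R - k (X w)) ^+ 2)%:E =
   \int[P]_w ((posterior (X w) - k (X w)) ^+ 2)%:E +
   \int[P]_w (posterior (X w) * (1 - posterior (X w)))%:E)%E.
Proof.
move=> mk.
have mpost := measurable_posterior.
have mX : measurable_fun [set: T] X by exact: measurable_noisy_obs.
have mg : measurable_fun [set: R] (fun x => (posterior x - k x) ^+ 2).
  by apply: measurable_funX; exact: measurable_funB.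
have mg' : measurable_fun [set: R] (fun x => posterior x * (1 - posterior x)).
  by apply: measurable_funM => //; exact: measurable_funB.
have g'0 x : 0 <= posterior x * (1 - posterior x).
  by case/andP: (posterior_itv x) => ? ?; rewrite mulr_ge0 ?subr_ge0.
rewrite -ge0_integralD//; last 4 first.
- by move=> w _; rewrite lee_fin sqr_ge0.
- by apply/measurable_EFinP; exact: (measurableT_comp mg mX).
- by move=> w _; rewrite lee_fin.
- by apply/measurable_EFinP; exact: (measurableT_comp mg' mX).
under [RHS]eq_integral do rewrite -EFinD.
rewrite (integral_noisy_obs_density (f := fun b x => (b%:R - k x) ^+ 2)); last 2 first.
- by move=> b; apply: measurable_funX; exact: measurable_funB.
- by move=> b x; exact: sqr_ge0.
rewrite (integral_noisy_obs_density (f := fun b x =>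
  (posterior x - k x) ^+ 2 + posterior x * (1 - posterior x))); last 2 first.
- by move=> b; exact: measurable_funD.
- by move=> b x; rewrite addr_ge0 ?sqr_ge0.
apply: eq_integral => z _; congr _%:E.
rewrite posteriorM.
have := joint_density_gt0 true z; have := joint_density_gt0 false z.
move: (joint_density true z) (joint_density false z) => a b b0 a0.
rewrite !mulrb /=.
by field; rewrite gt_eqF// addr_gt0.
Qed.

(** With [w] the total density, [joint_density true - p w = p (1 - p) (1 - 2 pN) (pdf1 - pdf0)].
    Dividing by [w], squaring and weighting by [w] gives exactly a multiple of [chi2_density]. *)
Lemma posterior_variance_le :
  (\int[P]_w ((posterior (X w) - p) ^+ 2)%:E <=
   ((p * (1 - p) * (1 - 2 * pN)) ^+ 2 * (expR (sigma ^- 2) - 1))%:E)%E.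
Proof.
(* [q] is a convex combination of [p] and [1 - p], hence strictly inside even when [pN] is [0] or
   [1]. *)
have q01 : 0 < q < 1.
  by case/andP: p01 => p0 p1; case/andP: pN01 => n0 n1; apply/andP; split; nra.
have c_ge0 := sqr_ge0 (p * (1 - p) * (1 - 2 * pN)).
rewrite (integral_noisy_obs_density (f := fun b x => (posterior x - p) ^+ 2));
  last 2 first.
- move=> b; apply: measurable_funX; apply: measurable_funB => //.
  exact: measurable_posterior.
- by move=> b x; exact: sqr_ge0.
have q01W : 0 <= q <= 1 by case/andP: q01 => ? ?; rewrite !ltW.
rewrite (_ : sigma ^- 2 = (sigma^-1 - 0) ^+ 2); last by rewrite subr0 exprVn.
rewrite EFinM.
apply: le_trans (lee_wpmul2l _ (normal_pdf_chi2_mixture 0 sigma^-1 q01));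
  last by rewrite lee_fin.
rewrite -ge0_integralZl_EFin//; last 2 first.
- by move=> x _; rewrite lee_fin chi2_density_ge0.
- by apply/measurable_EFinP; exact: measurable_chi2_density.
rewrite le_eqVlt; apply/orP; left; apply/eqP.
apply: eq_integral => z _; rewrite -EFinM; congr _%:E.
have mixE : joint_density true z + joint_density false z =
    (1 - q) * pdf0 z + q * pdf1 z by rewrite /joint_density; ring.
rewrite -mulrDr posteriorM mixE /chi2_density /joint_density.
have := normal_mixture_gt0 0 sigma^-1 z q01W.
move: (pdf1 z) (pdf0 z) => v u w0.
by field; rewrite gt_eqF.
Qed.

(** [eta] and [posterior] have equal integrals over Borel sets under the law [mu] of the
    observation, so they agree [mu]-almost everywhere; the mean squares are then compared under
    [mu]. *)
Lemma integral_regression (eta h : R -> R) :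
  measurable_fun [set: R] h -> is_regression P (bitR R S) X eta ->
  (\int[P]_w ((eta (X w) - h (X w)) ^+ 2)%:E =
   \int[P]_w ((posterior (X w) - h (X w)) ^+ 2)%:E)%E.
Proof.
move=> mh [meta ieta etaE].
have mX : measurable_fun [set: T] X by exact: measurable_noisy_obs.
have mpost := measurable_posterior.
pose XRV : {RV P >-> R} := HB.pack X (isMeasurableFun.Build _ _ _ _ _ mX).
pose mu := distribution P XRV.
have imu : mu.-integrable [set: R] (EFin \o eta).
  apply: integrable_pushforward => //.
    exact/measurable_EFinP.
have eta_post : ae_eq mu [set: R] (EFin \o eta) (EFin \o posterior).
  apply: integral_ae_eq => //; first exact/measurable_EFinP.
  move=> B _ mB.
  have mXB : measurable (X @^-1` B) by exact: (measurable_funPTI XRV mB).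
  have indB (g : T -> R) : (\int[P]_(w in X @^-1` B) (g w)%:E =
      \int[P]_w (\1_B (X w) * g w)%:E)%E.
    rewrite integral_mkcond; apply: eq_integral => w _.
    rewrite /patch indicE (_ : (w \in X @^-1` B) = (X w \in B))//.
    by case: ifPn; rewrite ?mul1r ?mul0r.
  transitivity (\int[P]_(w in X @^-1` B) (eta (X w))%:E)%E.
    rewrite integral_pushforward//; first exact/measurable_EFinP.
    exact: integrableS ieta.
  rewrite etaE// indB integral_bit_posterior// -indB.
  rewrite ge0_integral_pushforward//.
    by apply/measurable_funTS/measurable_EFinP.
  by move=> x _; rewrite lee_fin; case/andP: (posterior_itv x).
have transfer (k : R -> R) : measurable_fun [set: R] k ->
    (\int[P]_w ((k (X w) - h (X w)) ^+ 2)%:E =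
     \int[mu]_x ((k x - h x) ^+ 2)%:E)%E.
  move=> mk; rewrite ge0_integral_pushforward//.
    apply/measurable_EFinP; apply: measurable_funX; exact: measurable_funB.
  by move=> x _; rewrite lee_fin sqr_ge0.
rewrite !transfer//; apply: ge0_ae_eq_integral => //.
- apply/measurable_EFinP; apply: measurable_funX; exact: measurable_funB.
- apply/measurable_EFinP; apply: measurable_funX; exact: measurable_funB.
- by move=> x _; rewrite lee_fin sqr_ge0.
- by move=> x _; rewrite lee_fin sqr_ge0.
- by apply: filterS eta_post => x /(_ I) /= [->].
Qed.
End posterior.

(** * The sigmoid class and the bound on the approximation error *)

Lemma measurable_sigmoid_class (R : realType) (h : R -> R) :
  sigmoid_class R h -> measurable_fun [set: R] h.
Proof.
move=> [a [b ->]]; apply: measurable_funM => //; apply: measurable_invr_gt0.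
  apply: measurable_funD => //; apply: measurableT_comp => //.
  by apply: measurableT_comp => //; apply: measurable_funD => //;
    exact: measurable_funM.
by move=> x; rewrite addr_gt0 ?expR_gt0.
Qed.

Lemma cst_sigmoid_class (R : realType) (p : R) : 0 < p < 1 ->
  sigmoid_class R (fun=> p).
Proof.
(* Zero slope, and the logit of [p] as intercept. *)
move=> /andP[p0 p1]; exists 0, (ln (p / (1 - p))); apply/funext => x.
rewrite mul0r add0r /sigmoid expRN lnK ?posrE ?divr_gt0 ?subr_gt0//.
have -> : 1 + (p / (1 - p))^-1 = p^-1 by field; rewrite !gt_eqF ?subr_gt0.
by rewrite div1r invrK.
Qed.

(** Optimality of [h] is tested against the constant [p]; removing the common posterior term turns
    it into a comparison of distances to the posterior. *)
Lemma approx_error_le (R : realType) (p pN sigma : R) d (T : measurableType d)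
    (P : probability T R) (S N : {RV P >-> bool}) (Z : {RV P >-> R})
    (eta h : R -> R) :
  0 < p < 1 -> 0 <= pN <= 1 -> 0 < sigma ->
  has_law S (bernoulli_prob p) -> has_law N (bernoulli_prob pN) ->
  has_law Z (normal_prob 0 1) -> independent_rv P S N ->
  independent_rv P (fun w => (S w, N w)) Z ->
  is_regression P (bitR R S) (noisy_obs S N Z sigma) eta ->
  is_best_predictor P (sigmoid_class R)
    (bitR R S) (noisy_obs S N Z sigma) h ->
  (approx_error P (noisy_obs S N Z sigma) eta h <=
   ((p * (1 - p) * (1 - 2 * pN)) ^+ 2 * (expR (sigma ^- 2) - 1))%:E)%E.
Proof.
move=> p01 pN01 sigma0 lS lN lZ SN SNZ reg [Hh hbest].
have mh := measurable_sigmoid_class Hh.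
apply: le_trans (posterior_variance_le p01 pN01 sigma0 lS lN lZ SN SNZ).
rewrite /approx_error unlock.
rewrite (integral_regression p01 pN01 sigma0 lS lN lZ SN SNZ mh reg).
have := hbest _ (cst_sigmoid_class p01); rewrite unlock /bitR.
rewrite (mean_square_error_posterior p01 pN01 sigma0 lS lN lZ SN SNZ mh).
rewrite (mean_square_error_posterior p01 pN01 sigma0 lS lN lZ SN SNZ
  (measurable_cst p)).
have post01 x := posterior_itv sigma p01 pN01 x.
have mpost := measurable_posterior sigma p01 pN01.
have mX : measurable_fun [set: T] (noisy_obs S N Z sigma).
  exact: measurable_noisy_obs.
(* The common term cancels only if finite; its integrand is at most [1] under a probability. *)
rewrite leeD2rE// ge0_fin_numE; last first.
  by apply: integral_ge0 => w _; case/andP: (post01 (noisy_obs S N Z sigma w))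
    => ? ?; rewrite lee_fin mulr_ge0 ?subr_ge0.
apply: (@le_lt_trans _ _ (\int[P]_(w in [set: T]) 1%:E)%E); last first.
  by rewrite integral_cst// mul1e (le_lt_trans (probability_le1 _ _)) ?ltry.
apply: ge0_le_integral => //.
- by move=> w _; case/andP: (post01 (noisy_obs S N Z sigma w))
    => ? ?; rewrite lee_fin mulr_ge0 ?subr_ge0.
- apply/measurable_EFinP; apply: (measurableT_comp (f := fun x =>
    posterior p pN sigma x * (1 - posterior p pN sigma x)) _ mX).
  by apply: measurable_funM => //; exact: measurable_funB.
- by move=> w _; case/andP: (post01 (noisy_obs S N Z sigma w))
    => ? ?; rewrite lee_fin mulr_ile1 ?subr_ge0// gerBl.
Qed.

(** * Numerical estimates and the final bound *)

(** From [expR (- x) >= 1 - x] follows [expR x - 1 <= x / (1 - x)], and [1 - x >= 1 / 2]. *)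
Lemma expR_sub1_le2 (R : realType) (x : R) : 0 <= x <= 2^-1 ->
  expR x - 1 <= 2 * x.
Proof.
move=> /andP[x0 x1].
have := expR_ge1Dx (- x); rewrite expRN => h.
have e0 := expR_gt0 x.
have : (1 - x) * expR x <= 1 by rewrite -ler_pdivlMr// div1r.
nra.
Qed.

(** Here [n] stands for [sigma^2], [c] for [(1 - 2 pN)^2], [v] for [q (1 - q)]. After division by
    [c], the first two terms leave at least [1 / (2 n)], the [v] term costs at most [1 / (32 n)],
    and the [K] and [r] terms are nonnegative. *)
Lemma leading_terms_ge (R : realType) (c K r v n : R) :
  0 <= c -> 0 <= K -> 0 <= r -> 0 <= v <= 4^-1 -> 4 <= n ->
  c / (8 * n) <= 3 * c / (4 * n) - c / (4 * (v + n)) + c * K / (8 * n ^+ 2) +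
    2 * c * (r - v) / (4 * n * (v + n)).
Proof.
move=> c0 K0 r0 /andP[v0 v1] n4.
have n0 : 0 < n by lra.
have vn0 : 0 < v + n by lra.
pose i := n^-1; pose j := (v + n)^-1.
have i0 : 0 < i by rewrite invr_gt0.
have j0 : 0 < j by rewrite invr_gt0.
have ji : j <= i by rewrite lef_pV2 ?posrE// lerDr.
have i4 : i <= 4^-1 by rewrite lef_pV2 ?posrE.
rewrite -subr_ge0 (_ : _ - _ = c * (3 / 4 * i - j / 4 + K * i ^+ 2 / 8
  + (r - v) / 2 * (i * j) - i / 8)); last first.
  by rewrite /i /j; field; rewrite !gt_eqF.
apply: mulr_ge0 => //.
have ij0 : 0 <= i * j by rewrite mulr_ge0 ?ltW.
have ij4 : i * j <= i / 4 by apply: ler_wpM2l; [exact: ltW|exact: le_trans ji i4].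
have Ki0 : 0 <= K * i ^+ 2 by rewrite mulr_ge0 ?sqr_ge0.
have rij : 0 <= r * (i * j) by rewrite mulr_ge0.
have vij : v * (i * j) <= 4^-1 * (i * j) by rewrite ler_wpM2r.
nra.
Qed.

Theorem theorem3 (R : realType) (p pN : R)
    (p01 : 0 < p < 1) (pN01 : 0 <= pN <= 1) :
  let q : R := pN * (1 - p) + (1 - pN) * p in
  exists (C1 C2 : R) (r1 r2 : R -> R),
  \forall sigma \near +oo,
    [/\ `|r1 sigma| <= C1 * ((1 - 2 * pN) ^+ 2 / sigma ^+ 6),
        `|r2 sigma| <= C2 * ((1 - 2 * pN) ^+ 2
                             / (sigma ^+ 4 * (q * (1 - q) + sigma ^+ 2)))
      & forall (d : measure_display) (T : measurableType d)
               (P : probability T R)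
               (S N : {RV P >-> bool}) (Z : {RV P >-> R})
               (eta h : R -> R),
          has_law S (bernoulli_prob p) ->
          has_law N (bernoulli_prob pN) ->
          has_law Z (normal_prob 0 1) ->
          independent_rv P S N ->
          independent_rv P (fun w => (S w, N w)) Z ->
          is_regression P (bitR R S) (noisy_obs S N Z sigma) eta ->
          is_best_predictor P (sigmoid_class R)
            (bitR R S) (noisy_obs S N Z sigma) h ->
          (approx_error P (noisy_obs S N Z sigma) eta h <=
             (3 * (1 - 2 * pN) ^+ 2 / (4 * sigma ^+ 2)
              - (1 - 2 * pN) ^+ 2 / (4 * (q * (1 - q) + sigma ^+ 2))
              + (1 - 2 * pN) ^+ 2
                * (5 - 4 * pN + 4 * pN ^+ 2 + 14 * q - 2 * q ^+ 2)
                / (8 * sigma ^+ 4)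
              + 2 * (1 - 2 * pN) ^+ 2 * (pN * (1 - pN) - q * (1 - q))
                / (4 * sigma ^+ 2 * (q * (1 - q) + sigma ^+ 2))
              + r1 sigma + r2 sigma)%:E)%E ].
Proof.
move=> q; exists 0, 0, (fun=> 0), (fun=> 0).
(* Beyond [2] one has [sigma^2 >= 4], which serves both numerical lemmas. *)
exists 2; split => // sigma sigma_gt2; split; rewrite ?normr0 ?mul0r//.
move=> d T P S N Z eta h lS lN lZ SN SNZ reg best.
have sigma0 : 0 < sigma by exact: lt_trans sigma_gt2.
apply: le_trans (approx_error_le p01 pN01 sigma0 lS lN lZ SN SNZ reg best) _.
rewrite lee_fin !addr0.
case/andP: p01 => p0 p1; case/andP: pN01 => n0 n1.
have [q0 q1] : 0 <= q /\ q <= 1 by rewrite /q; split; nra.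
have s4 : 4 <= sigma ^+ 2 by nra.
have sN : sigma ^- 2 <= 4^-1 by rewrite lef_pV2 ?posrE// exprn_gt0.
apply: le_trans (_ : (1 - 2 * pN) ^+ 2 / (8 * sigma ^+ 2) <= _).
  have e2 : expR (sigma ^- 2) - 1 <= 2 * sigma ^- 2.
    apply: expR_sub1_le2; rewrite invr_ge0 sqr_ge0/=; lra.
  (* The factor [1 / 8] splits as [1 / 16], bounding [(p (1 - p))^2], times the [2] of the
     exponential estimate. *)
  rewrite exprMn [leRHS](_ : _ =
    16^-1 * (1 - 2 * pN) ^+ 2 * (2 * sigma ^- 2)); last first.
    by field; rewrite gt_eqF.
  apply: ler_pM => //.
  - by rewrite mulr_ge0 ?sqr_ge0.
  - by rewrite subr_ge0 -expR0 ler_expR invr_ge0 sqr_ge0.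
  - apply: ler_wpM2r; first exact: sqr_ge0.
    have y0 : 0 <= p * (1 - p) by rewrite mulr_ge0 ?subr_ge0 ?ltW.
    have y1 : p * (1 - p) <= 4^-1 by have := sqr_ge0 (p - 2^-1); nra.
    by move: y0 y1; move: (p * (1 - p)) => y y0 y1; nra.
apply: le_trans (leading_terms_ge (K := 5 - 4 * pN + 4 * pN ^+ 2 + 14 * q - 2 * q ^+ 2)
  (r := pN * (1 - pN)) (v := q * (1 - q)) (sqr_ge0 (1 - 2 * pN)) _ _ _ s4) _.
(* [K = (1 - 2 pN)^2 + 4 + 2 q (7 - q)]. *)
- by nra.
- by rewrite mulr_ge0 ?subr_ge0.
- apply/andP; split; first by rewrite mulr_ge0 ?subr_ge0.
  by have := sqr_ge0 (q - 2^-1); nra.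
by rewrite -exprM.
Qed.
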